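(* For $2g-2+n>0$ let $\mathcal{L}_{g,n}(t_1,\dots,t_n)$ be the Laurent polynomials obtained from the Laplace transform of the number of integral ribbon graphs, and put $\mathcal{L}_{0,2}(t_1,t_2)=\frac1{(t_1+t_2)^2}$, $s(t)=-t$, $x(t)=\frac{t+1}{t-1}+\frac{t-1}{t+1}$, $y(t)=\frac{t+1}{t-1}$, and $$K(t,t_1)=\frac12\left(\int_t^{s(t)}\mathcal{L}_{0,2}(u,t_1)\,du\right)\otimes dt_1\cdot\frac1{\big(y(t)-y(s(t))\big)\,dx(t)}.$$ Let $(g,n)$ satisfy $2g-2+n\ge2$ and $N=\{1,\dots,n\}$. Then the topological recursion $$ \begin{aligned} \mathcal{L}_{g,n}(t_N)=&-\frac1{16}\sum_{j=2}^n\frac{\partial}{\partial t_j}\left[\frac{t_j}{t_1^2-t_j^2}\left(\frac{(t_1^2-1)^3}{t_1^2}\mathcal{L}_{g,n-1}(t_{N\setminus\{j\}})-\frac{(t_j^2-1)^3}{t_j^2}\mathcal{L}_{g,n-1}(t_{N\setminus\{1\}})\right)\right]\\ &-\frac1{32}\frac{(t_1^2-1)^3}{t_1^2}\left[\mathcal{L}_{g-1,n+1}(t_1,t_1,t_{N\setminus\{1\}})+\sum_{\substack{g_1+g_2=g\\ I\sqcup J=N\setminus\{1\}}}^{\text{stable}}\mathcal{L}_{g_1,|I|+1}(t_1,t_I)\,\mathcal{L}_{g_2,|J|+1}(t_1,t_J)\right] \end{aligned} $$ is equivalent to the Eynard–Orantin recursion $$ \begin{aligned} \mathcal{L}_{g,n}(t_N)\,dt_N=\frac1{2\pi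 i}\int_\Gamma K(t,t_1)\Bigg[&\sum_{j=2}^n\bigg(\mathcal{L}_{g,n-1}(t,t_{N\setminus\{1,j\}})\,dt\otimes dt_{N\setminus\{1,j\}}\otimes\mathcal{L}_{0,2}(s(t),t_j)\,ds(t)\otimes dt_j\\ &\quad+\mathcal{L}_{g,n-1}(s(t),t_{N\setminus\{1,j\}})\,ds(t)\otimes dt_{N\setminus\{1,j\}}\otimes\mathcal{L}_{0,2}(t,t_j)\,dt\otimes dt_j\bigg)\\ &+\mathcal{L}_{g-1,n+1}(t,s(t),t_{N\setminus\{1\}})\,dt\otimes ds(t)\otimes dt_{N\setminus\{1\}}\\ &+\sum_{\substack{g_1+g_2=g\\ I\sqcup J=N\setminus\{1\}}}^{\text{stable}}\big(\mathcal{L}_{g_1,|I|+1}(t,t_I)\,dt\otimes dt_I\big)\otimes\big(\mathcal{L}_{g_2,|J|+1}(s(t),t_J)\,ds(t)\otimes dt_J\big)\Bigg] \end{aligned} $$ (that is, the right-hand side of the second formula equals $dt_N$ times the right-hand side of the first). Here the integration is in $t$ along the contour $\Gamma$ consisting of a circle of negative orientation centered at the origin with large radius $r>\max_{j\in N}|t_j|$ and an infinitesimally small circle around the origin of positive orientation. The ''stable'' sums are over all ordered decompositions $g=g_1+g_2$ ($g_1,g_2\ge0$), $I\sqcup J=N\setminus\{1\}$ with $2g_1-1+|I|>0$ and $2g_2-1+|J|>0$.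
   Context: Conventions: $dt_I=\bigotimes_{i\in I}dt_i$ and $t_I=(t_i)_{i\in I}$; $ds(t)=-dt$; $\frac1{dx(t)}$ is contraction with the vector field $\left(\frac{dx}{dt}\right)^{-1}\frac{\partial}{\partial t}$, so that applied to a quadratic differential $f(t)\,dt\otimes dt$ it gives $\frac{f(t)}{x'(t)}dt$, which is then integrated in $t$; tensor factors are regarded as commuting (symmetric differentials), identified by the variable names. The points $t_j$ are generic (nonzero, with $t_j^2$ distinct), and the small circle has radius smaller than $\min_j|t_j|$. Terms with negative genus are zero. A ribbon graph is a finite connected graph (loops and multiple edges allowed) with a cyclic order on the half-edges at each vertex; equivalently, a finite set of half-edges with a permutation $\sigma_0$ (cycles are vertices) and a fixed-point-free involution $\sigma_1$ (orbits are edges) generating a transitive group. Its faces are the cycles of $\sigma_0\sigma_1$. It has type $(g,n)$ if it has $n$ faces and $v-e+n=2-2g$, where $v,e$ are the numbers of vertices and edges. All vertices are required to have degree at least $3$, and the faces are labeled by $\{1,\dots,n\}$. $\mathrm{Aut}(\Gamma)$ is the group of bijections of the half-edges commuting with $\sigma_0$ and $\sigma_1$ and fixing each face. Sums over ribbon graphs of type $(g,n)$ run over isomorphism classes (isomorphisms preserving face labels). The edge-face incidence matrix of $\Gamma$, with $e(\Gamma)$ edges, is the $n\times e(\Gamma)$ matrix $A_\Gamma=[a_{i\eta}]$, where $a_{i\eta}\in\{0,1,2\}$ is the number of times edge $\eta$ appears in the boundary of face $i$. For $\mathbf{p}\in\mathbb{Z}_+^n$ (positive integers), $$N_{g,n}(\mathbf{p})=\sum_{\Gamma\text{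 of type }(g,n)}\frac{|\{\mathbf{x}\in\mathbb{Z}_+^{e(\Gamma)} : A_\Gamma\mathbf{x}=\mathbf{p}\}|}{|\mathrm{Aut}(\Gamma)|},\qquad L_{g,n}(w_1,\dots,w_n)=\sum_{\mathbf{p}\in\mathbb{Z}_+^n}N_{g,n}(\mathbf{p})e^{-(p_1w_1+\cdots+p_nw_n)},$$ a rational function of the $e^{-w_j}$. Substituting $e^{-w_j}=\frac{t_j+1}{t_j-1}$, set $\mathcal{L}_{g,n}(t_1,\dots,t_n)=\frac{\partial^n}{\partial t_1\cdots\partial t_n}L_{g,n}(w_1(t_1),\dots,w_n(t_n))$, which for $2g-2+n>0$ is a symmetric Laurent polynomial in $t_1^2,\dots,t_n^2$. *)

(* Defs.v *)
From mathcomp Require Import all_boot all_order all_algebra all_fingroup.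
From mathcomp Require Import finmap complex.
From mathcomp Require Import all_classical all_reals all_analysis.
Import Order.TTheory GRing.Theory Num.Theory.
Import numFieldNormedType.Exports.

Set Implicit Arguments.
Unset Strict Implicit.
Unset Printing Implicit Defensive.

Local Open Scope ring_scope.
Local Open Scope complex_scope.

(* 2 g - 2 + n > 0, free of truncated subtraction *)
Definition stable (g n : nat) : bool := (2 < 2 * g + n)%N.

(* A graph with e edges is carried by the half-edges 'I_(e.*2); in
   (s0, s1, lab), lab h is the label of the face through the half-edge h. *)
Notation rgraph e n := ('S_(e.*2) * 'S_(e.*2) * {ffun 'I_(e.*2) -> 'I_n})%type.

Section RibbonGraph.
Variables e n : nat.
Implicit Type G : rgraph e n.

Definition sigma0 G : 'S_(e.*2) := G.1.1.
Definition sigma1 G : 'S_(e.*2) := G.1.2.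
Definition face_label G : {ffun 'I_(e.*2) -> 'I_n} := G.2.

(* Products of permutations compose left to right, so that this is
   h |-> sigma0 (sigma1 h). *)
Definition face_perm G : 'S_(e.*2) := (sigma1 G * sigma0 G)%g.

Definition is_ribbon (g : nat) G : bool :=
  [&& [forall h, (sigma1 G h != h) && (sigma1 G (sigma1 G h) == h)],
      [transitive <<[set sigma0 G; sigma1 G]>>%g, on [set: 'I_(e.*2)] | 'P],
      [forall h, (3 <= #|porbit (sigma0 G) h|)%N],
      (* lab induces a bijection from the faces to 'I_n *)
      [forall h, forall k,
         (face_label G h == face_label G k) == (h \in porbit (face_perm G) k)],
      [forall i, exists h, face_label G h == i] &
      (* v - e + n = 2 - 2g *)
      (#|porbits (sigma0 G)| + n + 2 * g == #|porbits (sigma1 G)| + 2)%N].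

Definition is_iso G G' (phi : 'S_(e.*2)) : bool :=
  [forall h, [&& phi (sigma0 G h) == sigma0 G' (phi h),
                 phi (sigma1 G h) == sigma1 G' (phi h) &
                 face_label G' (phi h) == face_label G h]].

Definition isomorphic : rel (rgraph e n) :=
  fun G G' => [exists phi, is_iso G G' phi].

Definition rAut G : {set 'S_(e.*2)} := [set phi | is_iso G G phi].

(* One graph of type (g, n) with e edges in each isomorphism class. *)
Definition ribbon_classes (g : nat) : {set rgraph e n} :=
  let D := [set G | is_ribbon g G] in
  transversal (equivalence_partition isomorphic D) D.

(* Edges are the orbits of sigma1. Each half-edge of an edge lies on exactly
   one face and stands for one of the two sides of the edge. *)
Definition incidence G : 'M[nat]_(n, #|porbits (sigma1 G)|) :=
  \matrix_(i < n, eta < #|porbits (sigma1 G)|)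
    #|[set h in (enum_val eta : {set 'I_(e.*2)}) | face_label G h == i]|.

(* fset_set A is A for finite A; this set is finite since every column of the
   incidence matrix has a positive entry. *)
Definition lattice_count G (p : 'cV[nat]_n) : nat :=
  #|` fset_set [set x : 'cV[nat]_#|porbits (sigma1 G)| |
       (forall eta, (0 < x eta ord0)%N) /\ incidence G *m x = p]%classic |.

End RibbonGraph.

(* As 3 v <= 2 e, a graph of type (g, n) has e <= 6 g - 6 + 3 n edges. *)
Definition ribbonN (R : realType) (g n : nat) (p : 'cV[nat]_n) : R :=
  \sum_(e < 6 * g + 3 * n) \sum_(G in ribbon_classes e n g)
    (lattice_count G p)%:R / #|rAut G|%:R.

(* For w_1, ..., w_n > 0; all terms are nonnegative. *)
Definition laplaceN (R : realType) (g n : nat) (w : 'I_n -> R) : R :=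
  fine (\esum_(p in [set p : 'cV[nat]_n | forall i, (0 < p i ord0)%N]%classic)
    (ribbonN R g p * expR (- \sum_(i < n) (p i ord0)%:R * w i))%:E)%E.

(* exp (- w t) = (t + 1) / (t - 1); for t < -1 this is in ]0, 1[ and w t > 0. *)
Definition w_of (R : realType) (t : R) : R := - ln ((t + 1) / (t - 1)).

Definition partial (K : numFieldType) (n : nat) (j : 'I_n)
    (F : ('I_n -> K) -> K) (t : 'I_n -> K) : K :=
  derive1 (fun u : K => F [eta t with j |-> u] : K^o) (t j).

Definition mixed_partial (K : numFieldType) (n : nat)
    (F : ('I_n -> K) -> K) : ('I_n -> K) -> K :=
  foldr (fun j G => partial j G) F (enum 'I_n).

(* Families calL_{g,n} (t_1, ..., t_n) are functions of g and of the sequence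
   [:: t_1; ...; t_n], n being the size of the sequence. *)

(* f is a Laurent polynomial in t_1 ^ 2, ..., t_n ^ 2 on (C \ {0}) ^ n; c lists
   its monomials. *)
Definition laurent_sq (R : realType) (n : nat) (f : seq R[i] -> R[i]) : Prop :=
  exists c : seq (R[i] * n.-tuple int), forall t : n.-tuple R[i],
    (forall i, tnth t i != 0) ->
    f t = \sum_(m <- c) m.1 * \prod_(i < n) (tnth t i ^+ 2) ^ tnth m.2 i.

Definition symmetric_on (R : realType) (n : nat) (f : seq R[i] -> R[i]) : Prop :=
  forall t t' : n.-tuple R[i],
    (forall i, tnth t i != 0) -> perm_eq t t' -> f t = f t'.

(* f is the symmetric Laurent polynomial calL_{g,n}. The values on real
   t_1, ..., t_n < -1, where the Laplace transform converges, determine it. *)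
Definition is_calL (R : realType) (g n : nat) (f : seq R[i] -> R[i]) : Prop :=
  [/\ laurent_sq n f, symmetric_on n f &
      forall t : 'I_n -> R, (forall i, t i < -1) ->
        f [seq (t i)%:C | i : 'I_n] =
        (mixed_partial (fun u => laplaceN g (fun i => w_of (u i))) t)%:C].

Section Contour.
Variable R : realType.
Local Notation C := R[i].

Definition cintegral (a b : R) (f : R -> C) : C :=
  (\int[lebesgue_measure]_(x in `[a, b]%classic) complex.Re (f x)) +i*
  (\int[lebesgue_measure]_(x in `[a, b]%classic) complex.Im (f x)).

Definition cis (theta : R) : C := cos theta +i* sin theta.

(* Integral of f (z) dz along z = z0 * cis theta, theta from 0 to b. *)
Definition arc_integral (z0 : C) (b : R) (f : C -> C) : C :=
  cintegral 0 b (fun theta => f (z0 * cis theta) * ('i * z0 * cis theta)).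

(* The contour Gamma: a negative circle of radius r and a positive circle of
   radius eps, both centered at the origin. *)
Definition Gamma_integral (eps r : R) (f : C -> C) : C :=
  arc_integral eps%:C (2 * pi) f - arc_integral r%:C (2 * pi) f.

Definition invol (t : C) : C := - t.

(* ds(t) = -dt *)
Definition ds_dt : C := -1.

Definition xcoord (t : C) : C := (t + 1) / (t - 1) + (t - 1) / (t + 1).

Definition ycoord (t : C) : C := (t + 1) / (t - 1).

Definition calL02 (t1 t2 : C) : C := ((t1 + t2) ^+ 2)^-1.

(* A symmetric differential is represented by its coefficient with respect to
   the product of the dt's of its variables, and K by the coefficient of
   dt_1 (d/dt). As calL02 (u, t1) du has no residue, the integral from t to
   invol t does not depend on the path; the half-circle of radius |t| avoids the
   pole u = - t1 as long as |t| != |t1|, which holds on Gamma. *)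
Definition EOkernel (t t1 : C) : C :=
  2^-1 * arc_integral t pi (fun u => calL02 u t1) *
  ((ycoord t - ycoord (invol t)) * derive1 (xcoord : C -> C^o) t)^-1.

Variable calL : nat -> seq C -> C.
Variables g n : nat.

(* There are n.+1 variables; t ord0 is t_1. *)
Implicit Type t : 'I_n.+1 -> C.

Definition restr t (I : {set 'I_n.+1}) : seq C := [seq t i | i in I].

(* N \ {1} *)
Definition N1 : {set 'I_n.+1} := [set~ ord0].

Definition stable_split (g1 : 'I_g.+1) (I : {set 'I_n.+1}) : bool :=
  [&& I \subset N1, stable g1 #|I|.+1 & stable (g - g1) #|N1 :\: I|.+1].

Definition topological_rhs t : C :=
  let t1 := t ord0 in
  - 16^-1 * (\sum_(j in N1) partial j (fun v =>
       v j / (v ord0 ^+ 2 - v j ^+ 2) *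
       ((v ord0 ^+ 2 - 1) ^+ 3 / v ord0 ^+ 2 * calL g (restr v [set~ j]) -
        (v j ^+ 2 - 1) ^+ 3 / v j ^+ 2 * calL g (restr v N1))) t)
  - 32^-1 * ((t1 ^+ 2 - 1) ^+ 3 / t1 ^+ 2) *
    ((if g is g'.+1 then calL g' [:: t1, t1 & restr t N1] else 0) +
     \sum_(g1 < g.+1) \sum_(I | stable_split g1 I)
       calL g1 (t1 :: restr t I) * calL (g - g1)%N (t1 :: restr t (N1 :\: I))).

(* Coefficient of dt (x) dt (x) dt_{N \ {1}} of the bracket, t being tau. *)
Definition EObracket t (tau : C) : C :=
  \sum_(j in N1)
    (calL g (tau :: restr t (N1 :\ j)) * (calL02 (invol tau) (t j) * ds_dt) +
     (calL g (invol tau :: restr t (N1 :\ j)) * ds_dt) * calL02 tau (t j)) +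
  (if g is g'.+1 then calL g' [:: tau, invol tau & restr t N1] * ds_dt else 0) +
  \sum_(g1 < g.+1) \sum_(I | stable_split g1 I)
    calL g1 (tau :: restr t I) *
    (calL (g - g1)%N (invol tau :: restr t (N1 :\: I)) * ds_dt).

(* Coefficient of dt_N. *)
Definition EO_rhs (eps r : R) t : C :=
  (2 * pi%:C * 'i)^-1 *
  Gamma_integral eps r (fun tau => EOkernel tau (t ord0) * EObracket t tau).

End Contour.

(* Main.v *)
Require Import Defs.
From mathcomp Require Import all_boot all_order all_algebra complex.
From mathcomp Require Import all_classical all_reals all_analysis.
From mathcomp Require Import ring.
Import Order.TTheory GRing.Theory Num.Theory.
Import numFieldNormedType.Exports.
Local Open Scope ring_scope.
Local Open Scope complex_scope.

Set Implicit Arguments.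
Unset Strict Implicit.
Unset Printing Implicit Defensive.

(* The kernel is K(t, t_1) = - (t^2 - 1)^3 / (32 t (t^2 - t_1^2)), and all the
   calL_{g,n} are even Laurent polynomials in each variable, so that the
   integrand is H(t) dt / t for an even rational function H whose poles between
   the two circles are the +-t_j. Hence the contour integral is the difference
   of the mean values of H on the two circles. Expanding H in partial fractions
   in t^2, this difference follows from geometric series: the pole at t_1 gives
   the values at t_1, and the double poles at the t_j give the derivatives with
   respect to t_j. *)

(** The means are integrals over [[0, 2 pi]] of explicit functions of [cis], and three facts replace
    the residue theorem: a full period kills [cis (m x)] for a nonzero integer m, it kills the
    derivative of a periodic function, and the remainder of a geometric series of ratio c is
    O(|c|^n). By linearity only (z^2)^k / (z^2 - a^2)^p with p = 0, 1, 2 must be treated, and for p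
    = 1, 2 a recurrence over all integers k starts from k = 0. The natural variable is s = z^2. A
    pole at s = a^2 contributes minus the value of F / s there if it is simple, and minus the
    derivative of F / s with respect to s if it is double; the sign is due to the orientation of the
    contour. The 1/32 is the constant of the kernel. The 1/16 arises from it through 1/(t - t_j)^2 +
    1/(t + t_j)^2 = 2 (t^2 + t_j^2) / (t^2 - t_j^2)^2. The symmetry of the calL_{g,n} serves to
    match the order of arguments: the integrand puts the variable t in front, whereas [restr] lists
    variables in the order of their indices. *)

(** * Calculus of complex-valued functions of a real variable *)

Section ComplexValued.
Local Open Scope classical_set_scope.
Variable R : realType.
Local Notation C := R[i].
Local Notation Re := complex.Re.
Local Notation Im := complex.Im.
Implicit Types (f g : R -> C) (z w : C).

Lemma complex_ext z w : Re z = Re w -> Im z = Im w -> z = w.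
Proof. by case: z w => [a b] [c d] /= -> ->. Qed.

Lemma Re_add z w : Re (z + w) = Re z + Re w.
Proof. by case: z w => [a b] [c d]. Qed.

Lemma Im_add z w : Im (z + w) = Im z + Im w.
Proof. by case: z w => [a b] [c d]. Qed.

Lemma Re_mul z w : Re (z * w) = Re z * Re w - Im z * Im w.
Proof. by case: z w => [a b] [c d]. Qed.

Lemma Im_mul z w : Im (z * w) = Re z * Im w + Im z * Re w.
Proof. by case: z w => [a b] [c d]. Qed.

Lemma Re_inv z : Re z^-1 = Re z / (Re z ^+ 2 + Im z ^+ 2).
Proof. by case: z. Qed.

Lemma Im_inv z : Im z^-1 = - (Im z / (Re z ^+ 2 + Im z ^+ 2)).
Proof. by case: z. Qed.

Lemma sqr_norm_neq0 z : z != 0 -> Re z ^+ 2 + Im z ^+ 2 != 0.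
Proof.
case: z => [a b]; rewrite eq_complex /= => ab.
by rewrite paddr_eq0 ?sqr_ge0// !sqrf_eq0.
Qed.

(** Continuity is stated componentwise because [cintegral] integrates the real and the imaginary
    part separately; [cderiv] below follows the same pattern. *)
Definition ccont f : Prop :=
  continuous (fun x => Re (f x)) /\ continuous (fun x => Im (f x)).

Lemma ccont_cst z : ccont (fun=> z).
Proof. by split=> x; exact: cvg_cst. Qed.

Lemma ccontD f g : ccont f -> ccont g -> ccont (fun x => f x + g x).
Proof.
move=> [f1 f2] [g1 g2]; split=> x.
- by under eq_fun do rewrite Re_add; apply: cvgD; [exact: f1|exact: g1].
- by under eq_fun do rewrite Im_add; apply: cvgD; [exact: f2|exact: g2].
Qed.

Lemma ccontM f g : ccont f -> ccont g -> ccont (fun x => f x * g x).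
Proof.
move=> [f1 f2] [g1 g2]; split=> x.
- under eq_fun do rewrite Re_mul.
  by apply: cvgB; apply: cvgM; [exact: f1|exact: g1|exact: f2|exact: g2].
- under eq_fun do rewrite Im_mul.
  by apply: cvgD; apply: cvgM; [exact: f1|exact: g2|exact: f2|exact: g1].
Qed.

Lemma ccontX f n : ccont f -> ccont (fun x => f x ^+ n).
Proof.
move=> cf; elim: n => [|n IH].
  by under eq_fun do rewrite expr0; exact: ccont_cst.
by under eq_fun do rewrite exprS; exact: ccontM.
Qed.

Lemma ccontV f : (forall x, f x != 0) -> ccont f -> ccont (fun x => (f x)^-1).
Proof.
move=> f0 [f1 f2].
have c x : (Re (f y) ^+ 2 + Im (f y) ^+ 2)^-1 @[y --> x] -->
    (Re (f x) ^+ 2 + Im (f x) ^+ 2)^-1.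
  apply: cvgV; first exact: sqr_norm_neq0.
  by apply: cvgD; rewrite expr2; apply: cvgM;
    [exact: f1|exact: f1|exact: f2|exact: f2].
split=> x.
- by under eq_fun do rewrite Re_inv; apply: cvgM; [exact: f1|exact: c].
- under eq_fun do rewrite Im_inv.
  by apply: cvgN; apply: cvgM; [exact: f2|exact: c].
Qed.

Definition cderiv f (x : R) (d : C) : Prop :=
  is_derive x 1 (fun y => Re (f y)) (Re d) /\
  is_derive x 1 (fun y => Im (f y)) (Im d).

Lemma cderivV f x d : f x != 0 -> cderiv f x d ->
  cderiv (fun y => (f y)^-1) x (- d / f x ^+ 2).
Proof.
move=> f0 [d1 d2]; have n0 := sqr_norm_neq0 f0.
have dD : is_derive x 1 (fun y => Re (f y) ^+ 2 + Im (f y) ^+ 2)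
    (2 * (Re (f x) * Re d + Im (f x) * Im d)).
  apply: (@is_derive_eq _ _ _ _ _ _ _ _
    (is_deriveD (is_deriveM d1 d1) (is_deriveM d2 d2))).
  by rewrite /GRing.scale /=; ring.
have dV : is_derive x 1 (fun y => (Re (f y) ^+ 2 + Im (f y) ^+ 2)^-1)
    (- (2 * (Re (f x) * Re d + Im (f x) * Im d)) /
       (Re (f x) ^+ 2 + Im (f x) ^+ 2) ^+ 2).
  case: dD => dD1 dD2.
  split; first exact: derivableV.
  by rewrite deriveV// dD2 /GRing.scale /=; field.
split.
- have -> : (fun y => Re (f y)^-1) = fun y => Re (f y) *
      (Re (f y) ^+ 2 + Im (f y) ^+ 2)^-1 by apply/funext=> y; rewrite Re_inv.
  apply: (@is_derive_eq _ _ _ _ _ _ _ _ (is_deriveM d1 dV)).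
  rewrite /GRing.scale /= Re_mul Re_inv Im_inv expr2 Re_mul Im_mul.
  case: (f x) d {d1 d2 dD dV} f0 n0 => [a b] [c d] /= f0 n0.
  (* The squared modulus of [f x ^+ 2] is the square of that of [f x], so the only denominator left
     is the nonzero one of [n0]. *)
  have -> : (a * a - b * b) ^+ 2 + (a * b + b * a) ^+ 2 =
            (a ^+ 2 + b ^+ 2) ^+ 2.
    by ring.
  by field.
- have -> : (fun y => Im (f y)^-1) = fun y => - (Im (f y) *
      (Re (f y) ^+ 2 + Im (f y) ^+ 2)^-1) by apply/funext=> y; rewrite Im_inv.
  apply: (@is_derive_eq _ _ _ _ _ _ _ _ (is_deriveN (is_deriveM d2 dV))).
  rewrite /GRing.scale /= Im_mul Re_inv Im_inv expr2 Re_mul Im_mul.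
  case: (f x) d {d1 d2 dD dV} f0 n0 => [a b] [c d] /= f0 n0.
  have -> : (a * a - b * b) ^+ 2 + (a * b + b * a) ^+ 2 =
            (a ^+ 2 + b ^+ 2) ^+ 2.
    by ring.
  by field.
Qed.

Lemma continuous_itv_integrable (h : R -> R) (a b : R) : continuous h ->
  lebesgue_measure.-integrable `[a, b] (EFin \o h).
Proof.
move=> ch; apply: continuous_compact_integrable; first exact: segment_compact.
exact: continuous_subspaceT.
Qed.

Lemma cintegral_FTC (F f : R -> C) (a b : R) : a < b ->
  (forall x, cderiv F x (f x)) -> ccont f ->
  cintegral a b f = F b - F a.
Proof.
move=> ab dF [cf1 cf2].
have FTC (G h : R -> R) : continuous h ->
    (forall x : R, is_derive x 1 G (h x)) ->
    (\int[lebesgue_measure]_(x in `[a, b]) h x) = G b - G a.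
  move=> ch dG; have cG : continuous G.
    move=> x; apply: differentiable_continuous.
    by apply/derivable1_diffP; case: (dG x).
  rewrite /Rintegral (@continuous_FTC2 _ h G)//.
  - exact: continuous_subspaceT.
  - split; [by move=> x _; case: (dG x)| |].
    + by apply: cvg_at_right_filter; exact: cG.
    + by apply: cvg_at_left_filter; exact: cG.
  - by move=> x _; rewrite derive1E; case: (dG x).
apply: complex_ext => /=.
- rewrite (FTC _ _ cf1 (fun x => (dF x).1)).
  by case: (F a) (F b) => [? ?] [? ?].
- rewrite (FTC _ _ cf2 (fun x => (dF x).2)).
  by case: (F a) (F b) => [? ?] [? ?].
Qed.

Lemma cintegralD f g (a b : R) : ccont f -> ccont g ->
  cintegral a b (fun x => f x + g x) = cintegral a b f + cintegral a b g.
Proof.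
move=> [f1 f2] [g1 g2]; apply: complex_ext => /=.
- under eq_Rintegral do rewrite Re_add.
  by rewrite RintegralD//; exact: continuous_itv_integrable.
- under eq_Rintegral do rewrite Im_add.
  by rewrite RintegralD//; exact: continuous_itv_integrable.
Qed.

Lemma cintegralZ z f (a b : R) : ccont f ->
  cintegral a b (fun x => z * f x) = z * cintegral a b f.
Proof.
move=> [f1 f2].
have Z (k : R) (h : R -> R) : continuous h -> continuous (fun x => k * h x).
  by move=> ch x; apply: cvgM; [exact: cvg_cst|exact: ch].
apply: complex_ext => /=; rewrite ?Re_mul ?Im_mul /=.
- under eq_Rintegral do rewrite Re_mul.
  rewrite RintegralB//; [|exact: continuous_itv_integrable (Z _ _ _)..].
  by rewrite !RintegralZl//; exact: continuous_itv_integrable.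
- under eq_Rintegral do rewrite Im_mul.
  rewrite RintegralD//; [|exact: continuous_itv_integrable (Z _ _ _)..].
  by rewrite !RintegralZl//; exact: continuous_itv_integrable.
Qed.

Lemma eq_cintegral f g (a b : R) : f =1 g -> cintegral a b f = cintegral a b g.
Proof. by move=> /funext ->. Qed.

(** A bound on each component is enough, as it is only used to show that an integral vanishes. *)
Lemma cintegral_le f (a b K : R) : a <= b -> ccont f ->
  (forall x, `|f x| <= K%:C) ->
  `|Re (cintegral a b f)| <= K * (b - a) /\
  `|Im (cintegral a b f)| <= K * (b - a).
Proof.
move=> ab [f1 f2] fK.
have le (h : R -> R) : continuous h -> (forall x, `|h x| <= K) ->
    `|\int[lebesgue_measure]_(x in `[a, b]) h x| <= K * (b - a).
  move=> ch hK; apply: (le_trans (le_normr_Rintegral _ _)) => //.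
    exact: continuous_itv_integrable.
  have -> : K * (b - a) = \int[lebesgue_measure]_(x in `[a, b]) K.
    rewrite Rintegral_cst//= lebesgue_measure_itv/= lte_fin.
    by case: ltgtP ab => //= -> _; rewrite subrr.
  apply: le_Rintegral => //.
  - apply: (@continuous_itv_integrable (fun x => `|h x|)) => x.
    by apply: cvg_norm; exact: ch.
  - by apply: (@continuous_itv_integrable (fun=> K)) => x; exact: cvg_cst.
split; apply: le => // x.
- by rewrite -lecR; apply: le_trans (fK x); exact: normc_ge_Re.
- rewrite -lecR; apply: le_trans (fK x).
  case: (f x) => [c d] /=; rewrite normc_def /= lecR.
  by rewrite -sqrtr_sqr ler_wsqrtr// lerDr sqr_ge0.
Qed.

End ComplexValued.

(** * Integrals over arcs and full circles *)

Section Cis.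
Variable R : realType.
Local Open Scope classical_set_scope.
Local Notation C := R[i].
Local Notation Re := complex.Re.
Local Notation Im := complex.Im.
Implicit Types (z w c : C) (x y : R) (m : int).

Lemma cis0 : cis (0 : R) = 1.
Proof. by rewrite /cis cos0 sin0. Qed.

Lemma cisD x y : cis (x + y) = cis x * cis y.
Proof. by apply: complex_ext; rewrite /= ?cosD ?sinD //; ring. Qed.

Lemma norm_cis x : `|cis x| = 1.
Proof. by rewrite normc_def /= cos2Dsin2 sqrtr1. Qed.

Lemma cis_neq0 x : cis x != 0.
Proof. by rewrite -normr_eq0 norm_cis oner_eq0. Qed.

Lemma cisN x : cis (- x) = (cis x)^-1.
Proof.
by apply: (mulIf (cis_neq0 x)); rewrite -cisD addNr cis0 mulVf ?cis_neq0.
Qed.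

Lemma cis_pi : cis pi = - 1 :> C.
Proof.
by rewrite /cis cospi sinpi; apply: complex_ext => //=; rewrite oppr0.
Qed.

Lemma cis_2pi : cis (2 * pi) = 1 :> C.
Proof. by rewrite mulr_natl mulr2n cisD cis_pi mulrNN mulr1. Qed.

Lemma cis_expz m x : cis (m%:~R * x) = cis x ^ m.
Proof.
have nat_case (n : nat) : cis (n%:R * x) = cis x ^+ n.
  elim: n => [|n IH]; first by rewrite mul0r cis0.
  by rewrite -natr1 mulrDl mul1r cisD IH exprSr.
case: m => n; first exact: nat_case.
by rewrite NegzE mulrNz mulNr cisN nat_case -exprnN.
Qed.

Lemma ccont_cis (a : R) : ccont (fun x => cis (a * x)).
Proof.
split=> x /=; apply: continuous_comp.
- by apply: cvgM; [exact: cvg_cst|exact: cvg_id].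
- exact: continuous_cos.
- by apply: cvgM; [exact: cvg_cst|exact: cvg_id].
- exact: continuous_sin.
Qed.

Lemma cderiv_cis z w (a x : R) :
  cderiv (fun y => z + w * cis (a * y)) x ('i * a%:C * w * cis (a * x)).
Proof.
have da : is_derive x 1 (fun y : R => a * y) a.
  apply: (@is_derive_eq _ _ _ _ _ _ _ _
    (is_deriveM (is_derive_cst a x 1) (is_derive_id x 1))).
  by rewrite /GRing.scale /=; ring.
have dc : is_derive x 1 (fun y : R => cos (a * y)) (a * - sin (a * x)).
  apply: (@is_derive_eq _ _ _ _ _ _ _ _
    (@is_derive1_comp _ _ _ _ _ _ (is_derive_cos (a * x)) da)).
  by rewrite /GRing.scale /=; ring.
have ds : is_derive x 1 (fun y : R => sin (a * y)) (a * cos (a * x)).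
  apply: (@is_derive_eq _ _ _ _ _ _ _ _
    (@is_derive1_comp _ _ _ _ _ _ (is_derive_sin (a * x)) da)).
  by rewrite /GRing.scale /=; ring.
split.
- have -> : (fun y => Re (z + w * cis (a * y))) =
      (fun y => Re z + (Re w * cos (a * y) - Im w * sin (a * y))).
    by apply/funext=> y; rewrite Re_add Re_mul.
  apply: (@is_derive_eq _ _ _ _ _ _ _ _ (is_deriveD (is_derive_cst (Re z) x 1)
    (is_deriveB (is_deriveM (is_derive_cst (Re w) x 1) dc)
                (is_deriveM (is_derive_cst (Im w) x 1) ds)))).
  by rewrite /GRing.scale /= !(Re_mul, Im_mul) /=; ring.
- have -> : (fun y => Im (z + w * cis (a * y))) =
      (fun y => Im z + (Re w * sin (a * y) + Im w * cos (a * y))).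
    by apply/funext=> y; rewrite Im_add Im_mul.
  apply: (@is_derive_eq _ _ _ _ _ _ _ _ (is_deriveD (is_derive_cst (Im z) x 1)
    (is_deriveD (is_deriveM (is_derive_cst (Re w) x 1) ds)
                (is_deriveM (is_derive_cst (Im w) x 1) dc)))).
  by rewrite /GRing.scale /= !(Re_mul, Im_mul) /=; ring.
Qed.

Lemma cderiv_cisV z w (a x : R) : z + w * cis (a * x) != 0 ->
  cderiv (fun y => (z + w * cis (a * y))^-1) x
    (- ('i * a%:C * w * cis (a * x)) / (z + w * cis (a * x)) ^+ 2).
Proof. by move=> nz; apply: cderivV => //; exact: cderiv_cis. Qed.

(* [- (t1 + u)^-1] is a primitive of [calL02 u t1]. *)
Lemma arc_integral_L02 z t1 : `|z| != `|t1| ->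
  arc_integral z pi (fun u => calL02 u t1) = 2 * z / (z ^+ 2 - t1 ^+ 2).
Proof.
move=> zt; have nz x : t1 + (- z) * cis (1 * x) != 0.
  apply: contra_neq zt => /eqP; rewrite mulNr subr_eq0 => /eqP ->.
  by rewrite normrM norm_cis mulr1.
have nz' x : t1 + z * cis (1 * x) != 0.
  apply: contra_neq zt => /eqP; rewrite addr_eq0 => /eqP ->.
  by rewrite normrN normrM norm_cis mulr1.
have cf : ccont (fun x => - ('i * 1%:C * z * cis (1 * x)) /
    (t1 + z * cis (1 * x)) ^+ 2).
  under [X in ccont X]eq_fun do rewrite -mulN1r.
  apply: ccontM.
    do 2 (apply: ccontM; first exact: ccont_cst).
    exact: ccont_cis.
  apply: ccontV => [x|]; first by rewrite expf_neq0.
  apply/ccontX/ccontD; first exact: ccont_cst.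
  by apply: ccontM; [exact: ccont_cst|exact: ccont_cis].
rewrite /arc_integral /calL02.
rewrite (@eq_cintegral _ _ (fun x => -1 * (- ('i * 1%:C * z * cis (1 * x)) /
    (t1 + z * cis (1 * x)) ^+ 2))); last first.
  by move=> x; rewrite mul1r addrC; ring.
rewrite cintegralZ// (cintegral_FTC (pi_gt0 R)
  (fun x => cderiv_cisV (nz' x)) cf).
have h1 := nz 0; have h2 := nz' 0; move: h1 h2.
rewrite mulr0 mul1r cis0 cis_pi !mulr1 mulrN1 => h1 h2.
have h3 : z ^+ 2 - t1 ^+ 2 != 0.
  by rewrite subr_sqr mulf_neq0// -1?opprB ?oppr_eq0// addrC.
by field; rewrite h1 h2 h3.
Qed.

Lemma sub_cis_neq0 c x : `|c| < 1 -> 1 - c * cis x != 0.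
Proof.
move=> c1; rewrite subr_eq0; apply: contraTneq c1 => /(congr1 Num.norm).
by rewrite normr1 normrM norm_cis mulr1 => <-; rewrite ltxx.
Qed.

(** Writing w for [c * cis (m x)], the exponents n and p cover 1 / (1 - w), 1 / (1 - w)^2, w / (1 -
    w) and w / (1 - w)^2 at once. *)
Lemma ccont_geom c m n p : `|c| < 1 ->
  ccont (fun x => (c * cis (m%:~R * x)) ^+ n / (1 - c * cis (m%:~R * x)) ^+ p).
Proof.
move=> c1; have cw : ccont (fun x => c * cis (m%:~R * x)).
  by apply: ccontM; [exact: ccont_cst|exact: ccont_cis].
apply: ccontM; first exact: ccontX.
apply: ccontV => [x|]; last first.
  apply/ccontX; under [X in ccont X]eq_fun do rewrite -mulN1r.
  by apply: ccontD; [|apply: ccontM]; [exact: ccont_cst..|].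
by rewrite expf_neq0// sub_cis_neq0.
Qed.

Lemma cis_int_2pi m : cis (m%:~R * (2 * pi)) = 1 :> C.
Proof. by rewrite cis_expz cis_2pi exp1rz. Qed.

Lemma two_pi_gt0 : 0 < 2 * pi :> R.
Proof. by rewrite mulr_gt0 ?pi_gt0. Qed.

(** The primitive [z / (i m) * cis (m x)] has period [2 pi]. *)
Lemma cintegral_cis m z : m != 0 ->
  cintegral 0 (2 * pi) (fun x => z * cis (m%:~R * x)) = 0.
Proof.
move=> m0; pose w := z / ('i * (m%:~R : R)%:C).
have im0 : 'i * (m%:~R : R)%:C != 0.
  rewrite mulf_neq0 ?neq0Ci// eq_complex /= intr_eq0 (negbTE m0)//.
have dF x : cderiv (fun y => 0 + w * cis (m%:~R * y)) x (z * cis (m%:~R * x)).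
  have := cderiv_cis 0 w m%:~R x; congr (cderiv _ _ (_ * _)).
  by rewrite /w mulrC divfK.
have cf : ccont (fun x => z * cis (m%:~R * x)).
  by apply: ccontM; [exact: ccont_cst|exact: ccont_cis].
by rewrite (cintegral_FTC two_pi_gt0 dF cf) mulr0 cis0 cis_int_2pi subrr.
Qed.

Lemma cintegral_cst z : cintegral 0 (2 * pi) (fun=> z) = (2 * pi)%:C * z.
Proof.
apply: complex_ext; rewrite !(Re_mul, Im_mul) /= Rintegral_cst//=;
  by rewrite lebesgue_measure_itv/= lte_fin two_pi_gt0/= subr0; ring.
Qed.

Lemma le_geom_eq0 (a q K : R) : 0 <= q < 1 ->
  (forall n, `|a| <= q ^+ n * K) -> a = 0.
Proof.
move=> /andP[q0 q1] H; apply/eqP; rewrite -normr_le0 leNgt; apply/negP => a0.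
have : (fun n => q ^+ n * K) @ \oo --> 0 * K.
  by apply: cvgM; [apply: cvg_expr; rewrite ger0_norm|exact: cvg_cst].
rewrite mul0r => /cvgr_lt/(_ _ a0)[N _ /(_ N (leqnn N)) /=].
by rewrite ltNge H.
Qed.

(* The integral does not depend on [n], as the functions for [n] and [n.+1]
   differ by [w ^+ n.+1], which has mean 0; and it is O(|c| ^+ n). *)
Lemma cintegral_geom_pow c m n : `|c| < 1 -> m != 0 ->
  cintegral 0 (2 * pi)
    (fun x => (c * cis (m%:~R * x)) ^+ n.+1 /
              (1 - c * cis (m%:~R * x)) ^+ 1) = 0.
Proof.
move=> c1 m0.
pose J (k : nat) := cintegral 0 (2 * pi)
    (fun x => (c * cis (m%:~R * x)) ^+ k / (1 - c * cis (m%:~R * x)) ^+ 1).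
have w1 x : 1 - c * cis (m%:~R * x) != 0 by exact: sub_cis_neq0.
have w_le x : 1 - `|c| <= `|1 - c * cis (m%:~R * x)|.
  by apply: le_trans (lerB_dist _ _); rewrite normr1 normrM norm_cis mulr1.
have JS k : J k.+1 = J k.+2.
  rewrite /J; pose h x := c ^+ k.+1 * cis ((m * k.+1%:Z)%:~R * x).
  rewrite (@eq_cintegral _ _ (fun x => h x +
    (c * cis (m%:~R * x)) ^+ k.+2 / (1 - c * cis (m%:~R * x)) ^+ 1)).
    rewrite cintegralD; last exact: ccont_geom.
      by rewrite cintegral_cis ?add0r// mulf_neq0.
    by apply: ccontM; [exact: ccont_cst|exact: ccont_cis].
  move=> x; have := w1 x.
  rewrite /h !cis_expz -exprz_exp -exprnP -exprMn => w1x.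
  by move: (c * _) w1x => w w1x; rewrite (exprS w k.+1) expr1; field.
have J1 k : J n.+1 = J (n.+1 + k)%N.
  by elim: k => [|k ->]; [rewrite addn0|rewrite addSn JS addnS].
(* The norm takes its values in [R[i]]; [q] is the same number in [R], where the limit is taken. *)
pose q : R := Re `|c|.
have cq : `|c| = q%:C by rewrite RRe_real ?normr_real.
have q0 : 0 <= q by rewrite -ler0c -cq.
have q1 : q < 1 by rewrite -ltcR -cq.
have JK k : `|Re (J n.+1)| <= q ^+ k * ((1 - q)^-1 * (2 * pi)) /\
            `|Im (J n.+1)| <= q ^+ k * ((1 - q)^-1 * (2 * pi)).
  rewrite (J1 k) mulrA -[X in _ * X]subr0; apply: cintegral_le.
  - exact/ltW/two_pi_gt0.
  - exact: ccont_geom.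
  - move=> x; rewrite expr1 normrM normfV normrX normrM norm_cis mulr1 cq.
    rewrite rmorphM fmorphV rmorphB rmorph1 -rmorphXn /= -cq.
    apply: ler_pM.
    + by rewrite ler0c exprn_ge0.
    + by rewrite invr_ge0.
    + by rewrite lecR ler_wiXn2l ?leq_addl// ltW.
    + by rewrite lef_pV2 ?posrE ?normr_gt0 ?subr_gt0.
apply: complex_ext; apply: (@le_geom_eq0 _ q ((1 - q)^-1 * (2 * pi))).
- by rewrite q0 q1.
- by move=> k; have [] := JK k.
- by rewrite q0 q1.
- by move=> k; have [] := JK k.
Qed.

(** In 1 / (1 - w) = 1 + w / (1 - w) the last term has mean 0. *)
Lemma cintegral_geom c m : `|c| < 1 -> m != 0 ->
  cintegral 0 (2 * pi) (fun x => (1 - c * cis (m%:~R * x))^-1) = (2 * pi)%:C.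
Proof.
move=> c1 m0; have w1 x : 1 - c * cis (m%:~R * x) != 0 by exact: sub_cis_neq0.
rewrite (@eq_cintegral _ _ (fun x => 1 + (c * cis (m%:~R * x)) ^+ 1 /
    (1 - c * cis (m%:~R * x)) ^+ 1)); last first.
  by move=> x; rewrite !expr1; field; exact: w1.
rewrite cintegralD; [|exact: ccont_cst|exact: ccont_geom].
by rewrite cintegral_geom_pow// cintegral_cst mulr1 addr0.
Qed.

(** In 1 / (1 - w)^2 = 1 / (1 - w) + w / (1 - w)^2 the last term is [(i m)^-1] times the derivative
    in x of the periodic function 1 / (1 - w), hence has mean 0. *)
Lemma cintegral_geom_sq c m : `|c| < 1 -> m != 0 ->
  cintegral 0 (2 * pi) (fun x => (1 - c * cis (m%:~R * x)) ^- 2) = (2 * pi)%:C.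
Proof.
move=> c1 m0; have w1 x : 1 - c * cis (m%:~R * x) != 0 by exact: sub_cis_neq0.
have im0 : 'i * (m%:~R : R)%:C != 0.
  by rewrite mulf_neq0 ?neq0Ci// eq_complex /= intr_eq0 (negbTE m0).
have w1' x : 1 + (- c) * cis (m%:~R * x) != 0 by rewrite mulNr.
have cf p : ccont (fun x => (1 - c * cis (m%:~R * x)) ^- p).
  by have := ccont_geom m 0 p c1; under eq_fun do rewrite expr0 mul1r.
have dF x := cderiv_cisV (w1' x).
rewrite (@eq_cintegral _ _ (fun x => (1 - c * cis (m%:~R * x))^-1 +
   ('i * (m%:~R : R)%:C)^-1 * (- ('i * (m%:~R)%:C * - c * cis (m%:~R * x)) /
   (1 + - c * cis (m%:~R * x)) ^+ 2))); last first.
  by move=> x; field; rewrite w1' intr_eq0 m0 neq0Ci.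
have cG : ccont (fun x => - ('i * (m%:~R)%:C * - c * cis (m%:~R * x)) /
   (1 + - c * cis (m%:~R * x)) ^+ 2).
  have := ccontM (ccont_cst ('i * (m%:~R)%:C)) (ccont_geom m 1 2 c1).
  by congr (ccont _); apply/funext=> x; field; rewrite w1'.
rewrite cintegralD; [|exact: (cf 1)|by apply: ccontM; [exact: ccont_cst|]].
rewrite cintegral_geom// cintegralZ// (cintegral_FTC two_pi_gt0 dF cG).
by rewrite !mulr0 cis0 cis_int_2pi subrr mulr0 addr0.
Qed.

End Cis.

(** * Laurent polynomials in the square of a variable *)

Section EvenLaurent.

(** The inductive form reduces statements linear in F to monomials by induction. The last
    constructor makes the value at 0 immaterial, where negative powers are only default values. *)
Inductive even_laurent (K : fieldType) : (K -> K) -> Prop :=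
| even_laurent_mono c (k : int) : even_laurent (fun x => c * (x ^+ 2) ^ k)
| even_laurentD F G : even_laurent F -> even_laurent G ->
    even_laurent (fun x => F x + G x)
| even_laurent_ext F G : (forall x, x != 0 -> F x = G x) ->
    even_laurent F -> even_laurent G.

Variable K : fieldType.
Implicit Types (F G : K -> K) (c : K).

Lemma even_laurent_cst c : even_laurent (fun=> c).
Proof.
apply: even_laurent_ext (even_laurent_mono c 0) => x _.
by rewrite expr0z mulr1.
Qed.

Lemma even_laurent_sq : even_laurent (fun x : K => x ^+ 2).
Proof.
apply: even_laurent_ext (even_laurent_mono 1 1) => x _.
by rewrite expr1z mul1r.
Qed.

Lemma even_laurentM F G : even_laurent F -> even_laurent G ->
  even_laurent (fun x => F x * G x).
Proof.
move=> lF lG; elim: lF => {F} [c k|F1 F2 _ IH1 _ IH2|F1 F2 F12 _ IH].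
- elim: lG => {G} [c' k'|G1 G2 _ IH1 _ IH2|G1 G2 G12 _ IH].
  + apply: even_laurent_ext (even_laurent_mono (c * c') (k + k')) => x x0.
    by rewrite expfzDr ?expf_neq0//; ring.
  + by apply: even_laurent_ext (even_laurentD IH1 IH2) => x _; rewrite mulrDr.
  + by apply: even_laurent_ext IH => x x0; rewrite G12.
- by apply: even_laurent_ext (even_laurentD IH1 IH2) => x _; rewrite mulrDl.
- by apply: even_laurent_ext IH => x x0; rewrite F12.
Qed.

Lemma even_laurentX F n : even_laurent F -> even_laurent (fun x => F x ^+ n).
Proof.
move=> lF; elim: n => [|n IH].
  by apply: even_laurent_ext (even_laurent_cst 1) => x _; rewrite expr0.
by apply: even_laurent_ext (even_laurentM lF IH) => x _; rewrite exprS.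
Qed.

Lemma even_laurent_exprz (k : int) : even_laurent (fun x : K => (x ^+ 2) ^ k).
Proof.
by apply: even_laurent_ext (even_laurent_mono 1 k) => x _; rewrite mul1r.
Qed.

Lemma even_laurent_sum (I : Type) (s : seq I) (P : pred I) (F : I -> K -> K) :
  (forall i, P i -> even_laurent (F i)) ->
  even_laurent (fun x => \sum_(i <- s | P i) F i x).
Proof.
move=> lF; elim: s => [|i s IH].
  by apply: even_laurent_ext (even_laurent_cst 0) => x _; rewrite big_nil.
have [Pi|Pi] := boolP (P i).
  apply: even_laurent_ext (even_laurentD (lF i Pi) IH) => x _.
  by rewrite big_cons Pi.
by apply: even_laurent_ext IH => x _; rewrite big_cons (negbTE Pi).
Qed.

Lemma even_laurent_prod (I : Type) (s : seq I) (F : I -> K -> K) :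
  (forall i, even_laurent (F i)) ->
  even_laurent (fun x => \prod_(i <- s) F i x).
Proof.
move=> lF; elim: s => [|i s IH].
  by apply: even_laurent_ext (even_laurent_cst 1) => x _; rewrite big_nil.
by apply: even_laurent_ext (even_laurentM (lF i) IH) => x _; rewrite big_cons.
Qed.

Lemma even_laurentN F x : even_laurent F -> x != 0 -> F (- x) = F x.
Proof.
move=> lF x0; elim: lF => {F} [c k|F1 F2 _ IH1 _ IH2|F1 F2 F12 _ IH].
- by rewrite sqrrN.
- by rewrite IH1 IH2.
- by rewrite -!F12// oppr_eq0.
Qed.

End EvenLaurent.

(** * Derivatives over a numeric field *)

Section Derivatives.
Variable K : numFieldType.
Implicit Types (F G : K -> K) (a b c x : K).

Lemma is_derive_const c x : is_derive x 1 (fun=> c) 0.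
Proof. exact: is_derive_cst. Qed.

Lemma is_derive_var x : is_derive x 1 (fun y => y) 1.
Proof. exact: is_derive_id. Qed.

Lemma is_derive_add F G x d e : is_derive x 1 F d -> is_derive x 1 G e ->
  is_derive x 1 (fun y => F y + G y) (d + e).
Proof. exact: is_deriveD. Qed.

Lemma is_derive_sub F G x d e : is_derive x 1 F d -> is_derive x 1 G e ->
  is_derive x 1 (fun y => F y - G y) (d - e).
Proof. exact: is_deriveB. Qed.

Lemma is_derive_mul F G x d e : is_derive x 1 F d -> is_derive x 1 G e ->
  is_derive x 1 (fun y => F y * G y) (F x * e + G x * d).
Proof. exact: is_deriveM. Qed.

Lemma is_derive_inv F x d : F x != 0 -> is_derive x 1 F d ->
  is_derive x 1 (fun y => (F y)^-1) (- d / F x ^+ 2).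
Proof.
move=> F0 [dF1 dF2]; split; first exact: derivableV.
by rewrite deriveV// dF2 /GRing.scale /= mulrC mulrN mulNr.
Qed.

Lemma is_derive_neq0 F G x d : x != 0 ->
  (forall y, y != 0 -> F y = G y) -> is_derive x 1 F d -> is_derive x 1 G d.
Proof.
move=> x0 FG; apply: near_eq_is_derive.
near=> y; apply: FG; near: y; exact: (cvgr_neq0 x).
Unshelve. all: by end_near. Qed.

Lemma derive1_eq_neq0 F G x : x != 0 -> (forall y, y != 0 -> F y = G y) ->
  derive1 (F : K -> K^o) x = derive1 (G : K -> K^o) x.
Proof.
move=> x0 FG; rewrite !derive1E; apply: near_eq_derive.
near=> y; apply: FG; near: y; exact: (cvgr_neq0 x).
Unshelve. all: by end_near. Qed.

Lemma is_derive_exprz (k : int) x : x != 0 ->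
  is_derive x 1 (fun y => y ^ k) (k%:~R * x ^ (k - 1)).
Proof.
move=> x0.
have nat_case (n : nat) : is_derive x 1 (fun y => y ^+ n) (n%:R * x ^+ n.-1).
  split; first exact: exprn_derivable.
  by rewrite exp_derive /GRing.scale /= mulr1.
case: k => n.
  apply: (@is_derive_eq _ _ _ _ _ _ _ _ (nat_case n)).
  (* For n = 0 the exponents [n.-1] and [k - 1] differ, but both powers carry the factor 0. *)
  case: n => [|n]; first by rewrite !mul0r.
  by have -> : n.+1%:Z - 1 = n by rewrite -addn1 PoszD addrK.
have xn0 : x ^+ n.+1 != 0 by rewrite expf_neq0.
have -> : (fun y => y ^ Negz n) = fun y => (y ^+ n.+1)^-1 by [].
apply: (@is_derive_eq _ _ _ _ _ _ _ _
  (@is_derive_inv (fun y => y ^+ n.+1) x _ xn0 (nat_case n.+1))).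
rewrite NegzE mulrNz -opprD -PoszD addn1 -exprnN /= !mulNr -mulrA.
congr (- (_ * _)).
rewrite exprS (exprS x n.+1) exprS.
by field; rewrite x0 expf_neq0.
Qed.

Lemma derive1_xcoord x : x != 1 -> x != - 1 ->
  derive1 (fun t => (t + 1) / (t - 1) + (t - 1) / (t + 1) : K^o) x =
  - 8 * x / (x ^+ 2 - 1) ^+ 2.
Proof.
move=> x1 xN1; rewrite derive1E.
have n1 : x - 1 != 0 by rewrite subr_eq0.
have n2 : x + 1 != 0 by rewrite addr_eq0.
have d1 := is_derive_add (is_derive_var x) (is_derive_const 1 x).
have d2 := is_derive_sub (is_derive_var x) (is_derive_const 1 x).
have [_ ->] := is_derive_add
  (is_derive_mul d1 (@is_derive_inv (fun t => t - 1) _ _ n1 d2))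
  (is_derive_mul d2 (@is_derive_inv (fun t => t + 1) _ _ n2 d1)).
have -> : x ^+ 2 - 1 = (x - 1) * (x + 1) by ring.
by field; rewrite n1 n2.
Qed.

(** The factor [2 * b] is split off so that [d] stands for the derivative of F with respect to the
    square of its variable. The two coefficients obtained are then those of the partial fraction
    expansion with poles at [a ^+ 2] and [b ^+ 2]. *)
Lemma derive1_recursion_term F a b c d : a ^+ 2 != b ^+ 2 ->
  is_derive b 1 F (2 * b * d) ->
  derive1 (fun u => u / (a ^+ 2 - u ^+ 2) * (c - F u) : K^o) b =
  (a ^+ 2 + b ^+ 2) / (a ^+ 2 - b ^+ 2) ^+ 2 * (c - F b)
  + 2 * b ^+ 2 / (b ^+ 2 - a ^+ 2) * d.
Proof.
move=> ab dF; rewrite derive1E.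
have n1 : a ^+ 2 - b ^+ 2 != 0 by rewrite subr_eq0.
have n2 : b ^+ 2 - a ^+ 2 != 0 by rewrite subr_eq0 eq_sym.
have d1 := is_derive_sub (is_derive_const (a ^+ 2) b)
  (is_derive_mul (is_derive_var b) (is_derive_var b)).
have [_ ->] :=
  is_derive_mul (is_derive_mul (is_derive_var b) 
    (@is_derive_inv (fun u => a ^+ 2 - u ^+ 2) _ _ n1 d1))
                (is_derive_sub (is_derive_const c b) dF).
by field; rewrite n1 n2.
Qed.

Definition has_derivative F x d : Prop := is_derive x 1 F d.

(** In s = u^2 this is the derivative of c s^(k - 1), and [2 * x] is the derivative of s. *)
Lemma has_derivative_even_mono c (k : int) x : x != 0 ->
  has_derivative (fun u => c * (u ^+ 2) ^ k / u ^+ 2) x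
    (2 * x * (c * (k - 1)%:~R * (x ^+ 2) ^ (k - 2))).
Proof.
move=> x0.
have eq_exprz u : u != 0 -> c * u ^ (2 * (k - 1)) = c * (u ^+ 2) ^ k / u ^+ 2.
  move=> u0; have u2 : u ^+ 2 != 0 by rewrite expf_neq0.
  by rewrite -exprz_exp -[u ^ 2]/(u ^+ 2) expfzDr// -mulrA.
apply: is_derive_neq0 eq_exprz _; first exact: x0.
have H := is_derive_mul (is_derive_const c x)
  (@is_derive_exprz (2 * (k - 1)) x x0).
apply: (@is_derive_eq _ _ _ _ _ _ _ _ H).
have -> : 2 * (k - 1) - 1 = 2 * (k - 2) + 1 :> int by ring.
rewrite expfzDr// expr1z -exprz_exp -[x ^ 2]/(x ^+ 2) mulr0 addr0.
by rewrite !rmorphM /=; ring.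
Qed.

Lemma has_derivativeD F G x d e : has_derivative F x d ->
  has_derivative G x e -> has_derivative (fun y => F y + G y) x (d + e).
Proof. exact: is_derive_add. Qed.

End Derivatives.

(** * Differences of mean values on the two circles *)

Section LoopValue.
Variables (R : realType) (eps r : R).
Hypotheses (eps_gt0 : 0 < eps) (r_gt0 : 0 < r).
Local Notation C := R[i].
Implicit Types (F G : C -> C) (a b c v w z : C).

(* [v] is the difference of the mean values of [F] on the two circles, that is
   [1 / (2 pi i)] times the integral of [F tau / tau] along the contour. *)
Definition loop_value F v : Prop :=
  [/\ ccont (fun x => F (eps%:C * cis x)), ccont (fun x => F (r%:C * cis x)) &
      cintegral 0 (2 * pi) (fun x => F (eps%:C * cis x)) -
      cintegral 0 (2 * pi) (fun x => F (r%:C * cis x)) = (2 * pi)%:C * v].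

Definition on_contour z : Prop := `|z| = eps%:C \/ `|z| = r%:C.

Lemma on_contour_eps x : on_contour (eps%:C * cis x).
Proof. by left; rewrite normrM norm_cis mulr1 ger0_norm// ler0c ltW. Qed.

Lemma on_contour_r x : on_contour (r%:C * cis x).
Proof. by right; rewrite normrM norm_cis mulr1 ger0_norm// ler0c ltW. Qed.

Lemma on_contour_neq0 z : on_contour z -> z != 0.
Proof.
by case=> zE; rewrite -normr_gt0 zE ltcR.
Qed.

Lemma loop_value_ext F G v : (forall z, on_contour z -> F z = G z) ->
  loop_value F v -> loop_value G v.
Proof.
move=> FG.
have E1 : (fun x => F (eps%:C * cis x)) = fun x => G (eps%:C * cis x).
  by apply/funext=> x; apply/FG/on_contour_eps.
have E2 : (fun x => F (r%:C * cis x)) = fun x => G (r%:C * cis x).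
  by apply/funext=> x; apply/FG/on_contour_r.
by rewrite /loop_value E1 E2.
Qed.

Lemma loop_valueD F G v w : loop_value F v -> loop_value G w ->
  loop_value (fun z => F z + G z) (v + w).
Proof.
move=> [F1 F2 F3] [G1 G2 G3]; split; [exact: ccontD|exact: ccontD|].
by rewrite !cintegralD// [RHS]mulrDr -F3 -G3; ring.
Qed.

Lemma loop_valueZ c F v : loop_value F v ->
  loop_value (fun z => c * F z) (c * v).
Proof.
move=> [F1 F2 F3]; split; [exact: ccontM (ccont_cst _) _..|].
by rewrite !cintegralZ// -mulrBr F3 mulrCA.
Qed.

Lemma loop_value_sum (I : Type) (s : seq I) (P : pred I) (F : I -> C -> C)
    (v : I -> C) : (forall i, P i -> loop_value (F i) (v i)) ->
  loop_value (fun z => \sum_(i <- s | P i) F i z) (\sum_(i <- s | P i) v i).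
Proof.
move=> lF; elim: s => [|i s IH].
  have E c : (fun x => \sum_(i <- [::] | P i) F i (c * cis x)) = fun=> 0.
    by apply/funext=> x; rewrite big_nil.
  by rewrite big_nil; split; rewrite !E ?subrr ?mulr0//; exact: ccont_cst.
have [Pi|Pi] := boolP (P i).
  rewrite big_cons Pi; apply: loop_value_ext (loop_valueD (lF i Pi) IH) => z _.
  by rewrite big_cons Pi.
rewrite big_cons (negbTE Pi); apply: loop_value_ext IH => z _.
by rewrite big_cons (negbTE Pi).
Qed.

Lemma exprz_circle c x (k : int) :
  ((c * cis x) ^+ 2) ^ k = (c ^+ 2) ^ k * cis ((2 * k)%:~R * x).
Proof. by rewrite exprMn expfzMl cis_expz -exprz_exp. Qed.

(** Both means are 0 if k is nonzero, and both are 1 if k = 0, so that they cancel in every case. *)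
Lemma loop_value_exprz (k : int) : loop_value (fun z => (z ^+ 2) ^ k) 0.
Proof.
have cE m z : ccont (fun x => z * cis (m%:~R * x)).
  by apply: ccontM; [exact: ccont_cst|exact: ccont_cis].
have E c : (fun x => ((c * cis x) ^+ 2) ^ k) =1
    fun x => (c ^+ 2) ^ k * cis ((2 * k)%:~R * x).
  by move=> x; exact: exprz_circle.
split; [by rewrite (funext (E _))..|].
have [k0|k0] := eqVneq k 0.
  have I1 c : cintegral 0 (2 * pi) (fun x => ((c * cis x) ^+ 2) ^ k) =
      cintegral 0 (2 * pi) (fun=> 1).
    by apply: eq_cintegral => x; rewrite k0.
  apply: etrans (congr2 (fun u v => u - v) (I1 eps%:C) (I1 r%:C)) _.
  by rewrite subrr mulr0.
have I0 c : cintegral 0 (2 * pi) (fun x => ((c * cis x) ^+ 2) ^ k) = 0.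
  by rewrite (eq_cintegral _ _ (E c)) cintegral_cis// mulf_neq0.
apply: etrans (congr2 (fun u v => u - v) (I0 eps%:C) (I0 r%:C)) _.
by rewrite subrr mulr0.
Qed.

(* As [a != 0], the recurrence determines [G] in both directions. *)
Lemma loop_value_rec a (F G : int -> C -> C) (u v : int -> C) : a != 0 ->
  (forall k z, on_contour z -> G (k + 1) z = F k z + a * G k z) ->
  (forall k, v (k + 1) = u k + a * v k) ->
  (forall k, loop_value (F k) (u k)) ->
  loop_value (G 0) (v 0) -> forall k, loop_value (G k) (v k).
Proof.
move=> a0 GS vS lF lG; elim=> [//|k IH|k IH].
- have -> : k.+1%:Z = k%:Z + 1 by rewrite -PoszD addn1.
  rewrite vS; apply: loop_value_ext (loop_valueD (lF k) (loop_valueZ a IH)).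
  by move=> z zc; rewrite GS.
- have kE : - k%:Z = - k.+1%:Z + 1 by rewrite -addn1 PoszD; ring.
  move: (- k.+1%:Z) kE IH => m -> IH.
  have := loop_valueZ a^-1 (loop_valueD IH (loop_valueZ (-1) (lF m))).
  have -> : a^-1 * (v (m + 1) + -1 * u m) = v m by rewrite vS; field.
  by apply: loop_value_ext => z zc; rewrite GS//; field.
Qed.

(** * Simple and double poles at z^2 = a^2 between the circles *)

Section Pole.
Variable a : C.
Hypotheses (eps_a : eps%:C < `|a|) (a_r : `|a| < r%:C).

Lemma pole_neq0 : a != 0.
Proof. by rewrite -normr_gt0 (lt_trans _ eps_a)// ltcR. Qed.

Lemma on_contour_sub_neq0 z : on_contour z -> z ^+ 2 - a ^+ 2 != 0.
Proof.
move=> zc; rewrite subr_eq0; apply/eqP => /(congr1 Num.norm).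
rewrite !normrX => /eqP; rewrite eqrXn2// => /eqP za.
by case: zc => zE; move: eps_a a_r; rewrite -za zE ltxx.
Qed.

(** Up to a factor of modulus 1 these are the ratios of the geometric series: z^2 / a^2 on the inner
    circle and a^2 / z^2 on the outer one. The inversion explains the frequency -2 on the outer
    circle. *)
Let pole_eps := eps%:C ^+ 2 / a ^+ 2.
Let pole_r := a ^+ 2 / r%:C ^+ 2.

Let pole_eps_lt1 : `|pole_eps| < 1.
Proof.
rewrite normf_div !normrX ltr_pdivrMr ?exprn_gt0 ?normr_gt0 ?pole_neq0// mul1r.
by rewrite ltrXn2r//= ger0_norm// ler0c ltW.
Qed.

Let pole_r_lt1 : `|pole_r| < 1.
Proof.
have rn : `|r%:C| = r%:C by rewrite ger0_norm// ler0c ltW.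
rewrite normf_div !normrX rn ltr_pdivrMr ?exprn_gt0 ?ltcR// mul1r.
by rewrite ltrXn2r//= ler0c ltW.
Qed.

Let sub_eps x : (eps%:C * cis x) ^+ 2 - a ^+ 2 =
  - a ^+ 2 * (1 - pole_eps * cis (2%:~R * x)).
Proof.
by rewrite cis_expz exprMn /pole_eps; field; exact: pole_neq0.
Qed.

Let sub_r x : (r%:C * cis x) ^+ 2 - a ^+ 2 =
  a ^+ 2 / (pole_r * cis ((-2)%:~R * x)) * (1 - pole_r * cis ((-2)%:~R * x)).
Proof.
rewrite cis_expz -exprnN exprMn /pole_r; field.
by rewrite cis_neq0 pole_neq0 /= eq_complex /= gt_eqF.
Qed.

(** The inner circle gives the constant term -1 / a^2 of the expansion in z^2 / a^2; the expansion
    in w = a^2 / z^2 on the outer circle, a^-2 w / (1 - w), has no constant term. *)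
Lemma loop_value_inv : loop_value (fun z => (z ^+ 2 - a ^+ 2)^-1) (- a ^- 2).
Proof.
have E1 : (fun x => ((eps%:C * cis x) ^+ 2 - a ^+ 2)^-1) =
    fun x => - a ^- 2 * (1 - pole_eps * cis (2%:~R * x))^-1.
  by apply/funext=> x; rewrite sub_eps invfM invrN.
have E2 : (fun x => ((r%:C * cis x) ^+ 2 - a ^+ 2)^-1) =
    fun x => a ^- 2 * ((pole_r * cis ((-2)%:~R * x)) ^+ 1 /
                         (1 - pole_r * cis ((-2)%:~R * x)) ^+ 1).
  apply/funext=> x; rewrite sub_r; move: (pole_r * _) => w.
  by rewrite invfM invf_div !expr1 -mulrA mulrCA.
have c1 := ccont_geom 2 0 1 pole_eps_lt1.
have c2 := ccont_geom (-2) 1 1 pole_r_lt1.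
have c1' : ccont (fun x => (1 - pole_eps * cis (2%:~R * x))^-1).
  by move: c1; congr (ccont _); apply/funext=> x; rewrite expr0 expr1 mul1r.
split; rewrite ?E1 ?E2; [exact: ccontM (ccont_cst _) _..|].
rewrite !cintegralZ// cintegral_geom// cintegral_geom_pow//.
by rewrite mulr0 subr0 mulrC.
Qed.

(** Again only the inner circle contributes. On the outer one the function is a^-4 w^2 / (1 - w)^2,
    and w^2 / (1 - w)^2 = 1 - 2 / (1 - w) + 1 / (1 - w)^2 has mean 1 - 2 + 1 = 0. *)
Lemma loop_value_inv_sq :
  loop_value (fun z => (z ^+ 2 - a ^+ 2) ^- 2) (a ^- 4).
Proof.
pose w x := pole_r * cis ((-2)%:~R * x).
have w1 x : 1 - w x != 0 by exact: sub_cis_neq0.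
have E1 : (fun x => ((eps%:C * cis x) ^+ 2 - a ^+ 2) ^- 2) =
    fun x => a ^- 4 * (1 - pole_eps * cis (2%:~R * x)) ^- 2.
  by apply/funext=> x; rewrite sub_eps exprMn sqrrN -exprM invfM.
have E2 : (fun x => ((r%:C * cis x) ^+ 2 - a ^+ 2) ^- 2) =
    fun x => a ^- 4 * (1 + (- 2 * (1 - w x)^-1 + (1 - w x) ^- 2)).
  apply/funext=> x; rewrite sub_r -/(w x).
  have wx : w x != 0.
    rewrite mulf_neq0 ?cis_neq0// mulf_neq0 ?invr_neq0// expf_neq0 ?pole_neq0//.
    by rewrite eq_complex /= gt_eqF.
  by field; rewrite w1 wx pole_neq0.
have c1 : ccont (fun x => (1 - pole_eps * cis (2%:~R * x)) ^- 2).
  have := ccont_geom 2 0 2 pole_eps_lt1.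
  by congr (ccont _); apply/funext=> x; rewrite expr0 mul1r.
have c2 p : ccont (fun x => (1 - w x) ^- p).
  have := ccont_geom (-2) 0 p pole_r_lt1.
  by congr (ccont _); apply/funext=> x; rewrite expr0 mul1r.
have c3 : ccont (fun x => - 2 * (1 - w x)^-1).
  by apply: ccontM; [exact: ccont_cst|exact: (c2 1%N)].
have c4 : ccont (fun x => - 2 * (1 - w x)^-1 + (1 - w x) ^- 2).
  by apply: ccontD => //.
have c5 : ccont (fun x => 1 + (- 2 * (1 - w x)^-1 + (1 - w x) ^- 2)).
  by apply: ccontD => //; exact: ccont_cst.
split; rewrite ?E1 ?E2; [exact: ccontM (ccont_cst _) _..|].
rewrite !cintegralZ// cintegralD//; last exact: ccont_cst.
rewrite cintegralD// cintegralZ; last exact: (c2 1%N).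
by rewrite cintegral_cst cintegral_geom// !cintegral_geom_sq//; ring.
Qed.

(** Writing z^2 = (z^2 - a^2) + a^2 raises k by one at the cost of a pure power of z^2, whose loop
    value is 0. *)
Lemma loop_value_exprz_pole (k : int) :
  loop_value (fun z => (z ^+ 2) ^ k / (z ^+ 2 - a ^+ 2)) (- (a ^+ 2) ^ (k - 1)).
Proof.
have a2 : a ^+ 2 != 0 by rewrite expf_neq0// pole_neq0.
move: k; apply: (@loop_value_rec (a ^+ 2)
  (fun k z => (z ^+ 2) ^ k) _ (fun=> 0)).
- exact: a2.
- move=> k z zc; rewrite expfzDr ?expf_neq0 ?on_contour_neq0// expr1z.
  by field; exact: on_contour_sub_neq0.
- move=> k; rewrite add0r mulrN addrK.
  by rewrite -{1}[k](subrK 1) expfzDr// expr1z mulrC.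
- exact: loop_value_exprz.
- by apply: loop_value_ext loop_value_inv => z _; rewrite expr0z mul1r.
Qed.

(** The same splitting of z^2 now leaves a simple pole as inhomogeneous term, which turns the power
    of [a ^+ 2] into the derivative of s^(k - 1) at s = a^2, up to sign. *)
Lemma loop_value_exprz_double_pole (k : int) :
  loop_value (fun z => (z ^+ 2) ^ k / (z ^+ 2 - a ^+ 2) ^+ 2)
             (- ((k - 1)%:~R * (a ^+ 2) ^ (k - 2))).
Proof.
have a2 : a ^+ 2 != 0 by rewrite expf_neq0// pole_neq0.
move: k; apply: (@loop_value_rec (a ^+ 2)
  (fun k z => (z ^+ 2) ^ k / (z ^+ 2 - a ^+ 2)) _
  (fun k => - (a ^+ 2) ^ (k - 1))).
- exact: a2.
- move=> k z zc; rewrite expfzDr ?expf_neq0 ?on_contour_neq0// expr1z.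
  by field; exact: on_contour_sub_neq0.
- move=> k; have -> : k + 1 - 2 = (k - 2) + 1 by ring.
  have -> : k - 1 = (k - 2) + 1 by ring.
  by rewrite !expfzDr// expr1z !rmorphD /=; ring.
- exact: loop_value_exprz_pole.
- have -> : - ((0 - 1)%:~R * (a ^+ 2) ^ (0 - 2)) = a ^- 4.
    by rewrite sub0r mulN1r opprK -[a ^+ 4]/(a ^+ (2 * 2)) exprM.
  by apply: loop_value_ext loop_value_inv_sq => z _; rewrite expr0z mul1r.
Qed.

Lemma loop_value_simple F : even_laurent F ->
  loop_value (fun z => F z / (z ^+ 2 - a ^+ 2)) (- (F a / a ^+ 2)).
Proof.
elim=> {F} [c k|F G _ IHF _ IHG|F G FG _ IH].
- have := loop_valueZ c (loop_value_exprz_pole k).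
  rewrite expfzDr ?expf_neq0 ?pole_neq0// mulrN mulrA.
  by apply: loop_value_ext => z _; rewrite mulrA.
- rewrite mulrDl opprD; apply: loop_value_ext (loop_valueD IHF IHG) => z _.
  by rewrite mulrDl.
- rewrite -FG ?pole_neq0//; apply: loop_value_ext IH => z zc.
  by rewrite FG// on_contour_neq0.
Qed.

(** The number [d] is the derivative of F / s with respect to s = u^2 at a^2. Quantifying it
    existentially lets one induction carry the derivative and the loop value together. *)
Lemma loop_value_double F : even_laurent F -> exists2 d,
  has_derivative (fun u => F u / u ^+ 2) a (2 * a * d) &
  loop_value (fun z => F z / (z ^+ 2 - a ^+ 2) ^+ 2) (- d).
Proof.
elim=> {F} [c k|F G _ [d dF vF] _ [e eG vG]|F G FG _ [d dF vF]].
- exists (c * (k - 1)%:~R * (a ^+ 2) ^ (k - 2)).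
    exact/has_derivative_even_mono/pole_neq0.
  have := loop_valueZ c (loop_value_exprz_double_pole k).
  by rewrite mulrN mulrA; apply: loop_value_ext => z _; rewrite mulrA.
- exists (d + e).
    rewrite mulrDr; have := has_derivativeD dF eG.
    by congr (has_derivative _ _ _); apply/funext=> u; rewrite mulrDl.
  rewrite opprD; apply: loop_value_ext (loop_valueD vF vG) => z _.
  by rewrite mulrDl.
- exists d.
    apply: is_derive_neq0 dF; first exact: pole_neq0.
    by move=> u u0; rewrite FG.
  by apply: loop_value_ext vF => z zc; rewrite FG// on_contour_neq0.
Qed.

End Pole.

(* Partial fractions in [z ^+ 2]. *)
Lemma loop_value_recursion_term F a b : even_laurent F ->
  eps%:C < `|a| -> `|a| < r%:C -> eps%:C < `|b| -> `|b| < r%:C ->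
  a ^+ 2 != b ^+ 2 ->
  loop_value
    (fun z => F z * (z ^+ 2 + b ^+ 2) /
              ((z ^+ 2 - a ^+ 2) * (z ^+ 2 - b ^+ 2) ^+ 2))
    (- derive1 (fun u => u / (a ^+ 2 - u ^+ 2) *
                   (F a / a ^+ 2 - F u / u ^+ 2) : C^o) b).
Proof.
move=> lF ea ar eb br ab.
have n1 : a ^+ 2 - b ^+ 2 != 0 by rewrite subr_eq0.
have n2 : b ^+ 2 - a ^+ 2 != 0 by rewrite subr_eq0 eq_sym.
have [d dF vd] := loop_value_double eb br lF.
rewrite (derive1_recursion_term _ ab dF).
(* With s = z^2, [al] is the residue at a^2 of (s + b^2) / ((s - a^2) (s - b^2)^2) and [be] its
   coefficient of (s - b^2)^-2. The residue at b^2 is [- al], since the function is O(s^-2) at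
   infinity. *)
set al := (a ^+ 2 + b ^+ 2) / (a ^+ 2 - b ^+ 2) ^+ 2.
set be := 2 * b ^+ 2 / (b ^+ 2 - a ^+ 2).
have := loop_valueD (loop_valueZ al (loop_value_simple ea ar lF))
  (loop_valueD (loop_valueZ (- al) (loop_value_simple eb br lF))
               (loop_valueZ be vd)).
have -> : al * - (F a / a ^+ 2) + (- al * - (F b / b ^+ 2) + be * - d) =
  - (al * (F a / a ^+ 2 - F b / b ^+ 2) + be * d) by ring.
apply: loop_value_ext => z zc; rewrite /al /be; field.
by rewrite n1 n2 !on_contour_sub_neq0.
Qed.

End LoopValue.

(** * The kernel, the contour integral and the arguments of the calL_{g,n} *)

Section Recursion.
Variable R : realType.
Local Notation C := R[i].

(* At [z = 1] and [z = -1] both sides vanish, the left one because 0^-1 = 0. *)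
Lemma EOkernelE (z t1 : C) : z != 0 -> `|z| != `|t1| ->
  EOkernel z t1 * z = - (z ^+ 2 - 1) ^+ 3 / (32 * (z ^+ 2 - t1 ^+ 2)).
Proof.
move=> z0 zt; rewrite /EOkernel arc_integral_L02// /ycoord /invol.
have zt2 : z ^+ 2 - t1 ^+ 2 != 0.
  rewrite subr_eq0; apply: contra_neq zt => /(congr1 Num.norm).
  by rewrite !normrX => /eqP; rewrite eqrXn2// => /eqP.
have [->|z1] := eqVneq z 1.
  by rewrite subrr invr0 mulr0 addNr mul0r subrr mul0r invr0 mulr0 expr1n subrr
    expr0n oppr0 !mul0r.
have [->|zN1] := eqVneq z (-1).
  by rewrite addNr mul0r opprK subrr invr0 mulr0 subrr mul0r invr0 mulr0 sqrrN
    expr1n subrr expr0n oppr0 !mul0r.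
have -> : derive1 (@xcoord R : C -> C^o) z = - 8 * z / (z ^+ 2 - 1) ^+ 2.
  exact: derive1_xcoord.
have n1 : z - 1 != 0 by rewrite subr_eq0.
have n2 : z + 1 != 0 by rewrite addr_eq0.
have n3 : - z - 1 != 0 by rewrite -opprD oppr_eq0.
have n4 : z ^+ 2 - 1 != 0.
  have -> : z ^+ 2 - 1 = (z - 1) * (z + 1) by ring.
  by rewrite mulf_neq0.
(* This 4 and the 8 in the derivative of x multiply to the 32 of the kernel. *)
have -> : (z + 1) / (z - 1) - (- z + 1) / (- z - 1) = 4 * z / (z ^+ 2 - 1).
  by field; rewrite n1 n3 n4.
by field; rewrite zt2 z0 n4.
Qed.

(** On a circle centered at the origin dz = i z dtheta, so f(z) dz = i F(z) dtheta, and the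
    prefactor 1 / (2 pi i) leaves the mean values of F. *)
Lemma Gamma_integral_loop_value (eps r : R) (F f : C -> C) v :
  0 < eps -> 0 < r -> (forall z, on_contour eps r z -> f z * z = F z) ->
  loop_value eps r F v ->
  (2 * pi%:C * 'i)^-1 * Gamma_integral eps r f = v.
Proof.
move=> eps0 r0 fF [F1 F2 F3]; rewrite /Gamma_integral /arc_integral.
rewrite (@eq_cintegral _ _ (fun x => 'i * F (eps%:C * cis x))); last first.
  by move=> x; rewrite -fF; [ring|exact: on_contour_eps].
rewrite [X in _ - X](@eq_cintegral _ _ (fun x => 'i * F (r%:C * cis x)));
  last first.
  by move=> x; rewrite -fF; [ring|exact: on_contour_r].
rewrite !cintegralZ// -mulrBr F3 rmorphM /= rmorph_nat.
have pi0 : pi%:C != 0 :> C by rewrite eq_complex /= gt_eqF ?pi_gt0.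
by move: pi%:C pi0 => p p0; field; rewrite neq0Ci p0.
Qed.


Section Families.
Variables (f : seq C -> C) (rest : seq C).
Hypothesis rest_neq0 : all (fun y => y != 0) rest.

(** Only squares of the arguments enter, so the first k of them may be z or -z independently. The
    case k = 1 serves the single variable t, the case k = 2 the pair (t, -t) in the term of genus g
    - 1. *)
Lemma laurent_sq_even (k n : nat) : laurent_sq n f -> (k + size rest)%N = n ->
  exists2 F, even_laurent F & forall z x, z != 0 -> size x = k ->
    all (fun y => y ^+ 2 == z ^+ 2) x -> f (x ++ rest) = F z.
Proof.
move=> [c cE] kn.
exists (fun z => \sum_(m <- c) m.1 * \prod_(i < n)
  (if (i < k)%N then z ^+ 2 else (rest`_(i - k)) ^+ 2) ^ tnth m.2 i).
  apply: even_laurent_sum => m _; apply: even_laurentM.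
    exact: even_laurent_cst.
  apply: even_laurent_prod => i; case: ltnP => _.
    exact: even_laurent_exprz.
  exact: even_laurent_cst.
move=> z x z0 xk xz.
have xn : size (x ++ rest) == n by rewrite size_cat xk kn.
have nth_x i : (i < k)%N -> x`_i ^+ 2 = z ^+ 2.
  by move=> ik; apply/eqP/(all_nthP 0 xz); rewrite xk.
rewrite (cE (Tuple xn)); last first.
  move=> i; rewrite (tnth_nth 0) /= nth_cat xk; case: ltnP => ik.
    by rewrite -sqrf_eq0 nth_x// sqrf_eq0.
  apply: (all_nthP 0 rest_neq0).
  by rewrite ltn_subLR// kn.
apply: eq_bigr => m _; congr (_ * _); apply: eq_bigr => i _.
rewrite (tnth_nth 0) /= nth_cat xk; case: ltnP => ik //.
by rewrite nth_x.
Qed.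

Lemma even_laurent_head n : laurent_sq n f -> (size rest).+1 = n ->
  even_laurent (fun z => f (z :: rest)).
Proof.
move=> lf rn; have [F lF fF] := laurent_sq_even (k := 1) lf rn.
by apply: even_laurent_ext lF => z z0; rewrite (fF z [:: z])//= eqxx.
Qed.

Lemma even_laurent_head2 n : laurent_sq n f -> (size rest).+2 = n ->
  even_laurent (fun z => f [:: z, z & rest]) /\
  forall z, z != 0 -> f [:: z, - z & rest] = f [:: z, z & rest].
Proof.
move=> lf rn; have [F lF fF] := laurent_sq_even (k := 2) lf rn; split.
  by apply: even_laurent_ext lF => z z0; rewrite (fF z [:: z; z])//= eqxx.
move=> z z0; rewrite (fF z [:: z; - z])//= ?sqrrN ?eqxx//.
by rewrite (fF z [:: z; z])//= ?eqxx.
Qed.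

End Families.

Lemma symmetric_on_perm n (f : seq C -> C) s s' : symmetric_on n f ->
  size s = n -> all (fun y => y != 0) s -> perm_eq s s' -> f s = f s'.
Proof.
move=> sf sn s0 ss'.
have sn1 : size s == n by rewrite sn.
have sn2 : size s' == n by rewrite -(perm_size ss') sn.
apply: (sf (Tuple sn1) (Tuple sn2)) => // i.
rewrite (tnth_nth 0) /=; apply: (all_nthP 0 s0).
by rewrite sn.
Qed.

Section Sequences.
Variable n : nat.
Implicit Types (t : 'I_n.+1 -> C) (I : {set 'I_n.+1}) (j : 'I_n.+1).

Lemma size_restr t I : size (restr t I) = #|I|.
Proof. by rewrite size_image. Qed.

Lemma all_restr t I : (forall i, t i != 0) -> all (fun y => y != 0) (restr t I).
Proof. by move=> t0; apply/allP => y /mapP[i _ ->]. Qed.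

(** This relates a distinguished variable placed in front to the order of indices used by [restr];
    [v] is t with its j-th entry possibly changed. *)
Lemma perm_restr_cons t (v : 'I_n.+1 -> C) I j : j \in I ->
  (forall i, i \in I :\ j -> v i = t i) ->
  perm_eq (v j :: restr t (I :\ j)) (restr v I).
Proof.
move=> jI vt; have -> : restr t (I :\ j) = restr v (I :\ j).
  by apply/esym/eq_in_map => i; rewrite mem_enum; exact: vt.
rewrite -[v j :: _]/(map v (j :: enum (I :\ j))); apply: perm_map.
apply: uniq_perm; rewrite /= ?enum_uniq ?andbT ?mem_enum ?setD11// => i.
rewrite inE !mem_enum !inE; have [->|//] := eqVneq i j.
by rewrite jI.
Qed.

End Sequences.

End Recursion.

(** * Evaluation of the contour integral and comparison with the topological recursion *)

Theorem theorem7p2 (R : realType) (calL : nat -> seq R[i] -> R[i])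
  (calL_spec : forall g n : nat, (0 < n)%N -> stable g n -> is_calL g n (calL g))
  (g n : nat) (gn_ge2 : (4 <= 2 * g + n.+1)%N)
  (t : 'I_n.+1 -> R[i])
  (t_neq0 : forall i, t i != 0)
  (t_sq_inj : injective (fun i => t i ^+ 2))
  (eps r : R) (eps_gt0 : 0 < eps)
  (eps_lt : forall i, eps%:C < `|t i|) (r_gt : forall i, `|t i| < r%:C) :
  EO_rhs calL g eps r t = topological_rhs calL g t.
Proof.
have r_gt0 : 0 < r.
  by rewrite -ltcR; apply: le_lt_trans (r_gt ord0); exact: normr_ge0.
(* With [n.+1] variables in all, [P j] has n arguments. [Q] is the last bracket of [topological_rhs]
   with t_1 replaced by z. *)
pose P j z := calL g (z :: restr t (N1 n :\ j)).
pose Q z := (if g is g'.+1 then calL g' [:: z, z & restr t (N1 n)] else 0) +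
  \sum_(g1 < g.+1) \sum_(I | stable_split g1 I)
    calL g1 (z :: restr t I) * calL (g - g1)%N (z :: restr t (N1 n :\: I)).
have cardN1 : #|N1 n| = n by rewrite /N1 cardsC1 card_ord.
have spec_j j : j \in N1 n -> is_calL g n (calL g) /\ (#|N1 n :\ j|).+1 = n.
  move=> jN; have card_j : (#|N1 n :\ j|).+1 = n.
    by rewrite -[in RHS]cardN1 (cardsD1 j (N1 n)) jN.
  split=> //; apply: calL_spec; first by rewrite -card_j.
  by rewrite /stable; move: gn_ge2; rewrite addnS.
have P_even j : j \in N1 n -> even_laurent (P j).
  move=> /spec_j[[lP _ _] card_j].
  by apply: even_laurent_head lP _; [exact: all_restr|rewrite size_restr].
have split_even (g1 : 'I_g.+1) I : stable_split g1 I ->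
    even_laurent (fun z => calL g1 (z :: restr t I)) /\
    even_laurent (fun z => calL (g - g1)%N (z :: restr t (N1 n :\: I))).
  move=> /and3P[_ st1 st2].
  have [l1 _ _] := calL_spec _ _ (ltn0Sn _) st1.
  have [l2 _ _] := calL_spec _ _ (ltn0Sn _) st2.
  split.
    by apply: (even_laurent_head (all_restr _ t_neq0) l1); rewrite size_restr.
  by apply: (even_laurent_head (all_restr _ t_neq0) l2); rewrite size_restr.
have genus_even g' : g = g'.+1 ->
    even_laurent (fun z => calL g' [:: z, z & restr t (N1 n)]) /\
    forall z, z != 0 ->
      calL g' [:: z, - z & restr t (N1 n)] = calL g' [:: z, z & restr t (N1 n)].
  move=> gE; have st : stable g' n.+2.
    by move: gn_ge2; rewrite /stable gE mulnS -addnA add2n !addnS !ltnS.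
  have [l1 _ _] := calL_spec _ _ (ltn0Sn _) st.
  by apply: even_laurent_head2 l1 _; rewrite ?size_restr ?cardN1//;
    exact: all_restr.
have Q_even : even_laurent Q.
  apply: even_laurentD.
    case: (g) genus_even => [|g'] H; first exact: even_laurent_cst.
    by case: (H g').
  apply: even_laurent_sum => g1 _.
  apply: even_laurent_sum => I /split_even[l1 l2].
  exact: even_laurentM.
(* Evenness removes [invol] from the arguments of [calL], and the global sign is that of ds =
   -dt. *)
have bracketE z : z != 0 -> EObracket calL g t z =
    - \sum_(j in N1 n) P j z * ((- z + t j) ^- 2 + (z + t j) ^- 2) - Q z.
  move=> z0; rewrite /EObracket /ds_dt /invol -addrA opprD; congr (_ + _).
    rewrite -sumrN; apply: eq_bigr => j jN.
    have PN := even_laurentN (P_even j jN) z0.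
    by move: PN; rewrite /P /calL02 => ->; ring.
  congr (_ + _).
    case: (g) genus_even => [|g'] H; first by rewrite oppr0.
    by case: (H g') => // _ ->//; rewrite mulrN1.
  rewrite -sumrN; apply: eq_bigr => g1 _; rewrite -sumrN; apply: eq_bigr => I.
  move=> /split_even[_ l2].
  by move: (even_laurentN l2 z0) => /= ->; rewrite mulrN1 mulrN.
pose cube (z : R[i]) := (z ^+ 2 - 1) ^+ 3.
have cube_even F : even_laurent F -> even_laurent (fun z => cube z * F z).
  apply: even_laurentM; apply: even_laurentX; apply: even_laurentD.
    exact: even_laurent_sq.
  exact: even_laurent_cst.
pose a := t ord0.
have sq_neq j : j \in N1 n -> a ^+ 2 != t j ^+ 2.
  by rewrite !inE => j0; apply: contra_neq j0 => /t_sq_inj ->.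
(* [H] is z times the integrand; the signs of the kernel and of the bracket cancel. *)
pose H z := \sum_(j in N1 n) 16^-1 * (cube z * P j z * (z ^+ 2 + t j ^+ 2) /
    ((z ^+ 2 - a ^+ 2) * (z ^+ 2 - t j ^+ 2) ^+ 2)) +
  32^-1 * (cube z * Q z / (z ^+ 2 - a ^+ 2)).
pose V := \sum_(j in N1 n) 16^-1 *
    (- derive1 (fun u => u / (a ^+ 2 - u ^+ 2) *
       (cube a * P j a / a ^+ 2 - cube u * P j u / u ^+ 2) : R[i]^o) (t j)) +
  32^-1 * (- (cube a * Q a / a ^+ 2)).
have HV : loop_value eps r H V.
  apply: loop_valueD.
    apply: (loop_value_sum eps_gt0 r_gt0) => j jN; apply: loop_valueZ.
    by apply: (loop_value_recursion_term eps_gt0 r_gt0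
      (cube_even _ (P_even j jN))); rewrite ?eps_lt ?r_gt// sq_neq.
  apply: loop_valueZ.
  exact: (loop_value_simple eps_gt0 r_gt0 (eps_lt ord0) (r_gt ord0)
    (cube_even _ Q_even)).
transitivity V.
  apply: (Gamma_integral_loop_value eps_gt0 r_gt0 _ HV) => z zc.
  have z0 := on_contour_neq0 eps_gt0 r_gt0 zc.
  have zt i : z ^+ 2 - t i ^+ 2 != 0.
    by apply: on_contour_sub_neq0 zc; [exact: eps_lt|exact: r_gt].
  have za : `|z| != `|a|.
    case: zc => ->; last by rewrite gt_eqF// r_gt.
    by rewrite lt_eqF// eps_lt.
  rewrite mulrAC EOkernelE// bracketE// /H mulrDr; congr (_ + _).
    rewrite mulrN -mulNr mulr_sumr; apply: eq_bigr => j _; rewrite /cube.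
    have h1 : - z + t j != 0.
      apply: contraNneq (zt j) => h.
      by rewrite subr_sqr -[z - _]opprK opprB addrC h oppr0 mul0r.
    have h2 : z + t j != 0.
      by apply: contraNneq (zt j) => h; rewrite subr_sqr h mulr0.
    by move: (P j z) => p; rewrite -/a; field; rewrite h1 h2 /a !zt.
  by move: (Q z) => q; rewrite /cube -/a; field; exact: zt.
rewrite /V /topological_rhs -/a; congr (_ + _); last first.
  rewrite -/(Q a) /cube; move: (Q a) => q; ring.
rewrite mulNr -mulrN -sumrN mulr_sumr; apply: eq_bigr => j jN.
rewrite /partial; apply: (congr1 (fun w => 16^-1 * - w)).
(* Symmetry of [calL] is available at nonzero arguments, so the two functions of u are compared for
   u != 0 only; this determines the derivative at the nonzero point [t j]. *)
apply: (derive1_eq_neq0 (t_neq0 j)) => u u0.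
have j0 : ord0 == j = false.
  by apply/negbTE; move: jN; rewrite !inE eq_sym.
rewrite /= eqxx j0 -/a.
have [[_ sym _] card_j] := spec_j j jN.
pose v := [eta t with j |-> u].
have vE i : i \in N1 n :\ j -> v i = t i.
  by rewrite !inE /v /= => /andP[/negbTE ->].
have rest_eq : [set~ j] :\ ord0 = N1 n :\ j.
  by apply/setP => i; rewrite !inE andbC.
have perm_j := perm_restr_cons jN vE.
have perm_0 : perm_eq (v ord0 :: restr t (N1 n :\ j)) (restr v [set~ j]).
  rewrite -rest_eq; apply: perm_restr_cons; first by rewrite !inE j0.
  by move=> i; rewrite rest_eq; exact: vE.
have v0 : v ord0 = a by rewrite /v /= j0.
have vj : v j = u by rewrite /v /= eqxx.
have rest0 := all_restr (N1 n :\ j) t_neq0.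
rewrite v0 in perm_0; rewrite vj in perm_j.
have Pa : P j a = calL g (restr v [set~ j]).
  apply: (symmetric_on_perm sym _ _ perm_0); first by rewrite /= size_restr.
  by rewrite /= t_neq0.
have Pu : P j u = calL g (restr v (N1 n)).
  apply: (symmetric_on_perm sym _ _ perm_j); first by rewrite /= size_restr.
  by rewrite /= u0.
rewrite -/v -Pa -Pu /cube; congr (_ * (_ - _)); exact: mulrAC.
Qed.
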